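(* Let $\kappa$ be a regular uncountable cardinal, $\lambda>\kappa$ a singular (limit) cardinal and $\theta$ a cardinal with $2\leq\theta\leq\kappa$. Assume that the ideals named below exist, i.e. that there is a $[\lambda]^{<\theta}$-normal ideal on $P_\kappa(\lambda)$ and, in (i), a $[\tau]^{<\theta}$-normal ideal on $P_\kappa(\tau)$ for each cardinal $\tau$ with $\kappa\leq\tau<\lambda$, respectively, in (ii), a $[\chi]^{<\theta}$-normal ideal on $P_\kappa(\tau)$ for each cardinal $\tau$ with $\chi\leq\tau\leq\lambda$. (i) Suppose that $\overline\theta\leq \mathrm{cf}(\lambda)$ and that $\overline{\mathrm{cof}}(NS_{\kappa,\tau}^{[\tau]^{<\theta}})\leq\lambda^{<\overline\theta}$ for every cardinal $\tau$ with $\kappa\leq\tau<\lambda$. Then there is $A\in(NS_{\kappa,\lambda}^{[\lambda]^{<\theta}})^*$ such that $NS_{\kappa,\lambda}^{[\lambda]^{<\theta}}=NS_{\kappa,\lambda}^{\mathrm{cf}(\lambda)}\mid A$. (ii) Suppose that $\chi$ is a cardinal such that $\kappa\cdot(\mathrm{cf}(\lambda))^+\leq\chi<\lambda$ and $\overline{\mathrm{cof}}(NS_{\kappa,\tau}^{[\chi]^{<\theta}})\leq\lambda^{<\overline\theta}$ for every cardinal $\tau$ with $\chi\leq\tau<\lambda$. Then there is $A\in(NS_{\kappa,\lambda}^{[\lambda]^{<\theta}})^*$ such that $NS_{\kappa,\lambda}^{[\chi]^{<\theta}}\mid A = NS_{\kappa,\lambda}^{\mathrm{cf}(\lambda)}\mid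 A$.
   Context: Let $\kappa$ be a regular uncountable cardinal and $\sigma\geq\kappa$ a cardinal. For a set $X$ and a cardinal $\rho$, $P_\rho(X)=\{a\subseteq X: |a|<\rho\}$, and $\sigma^{<\rho}=|P_\rho(\sigma)|$ for infinite $\sigma$ (so $\sigma^{<\rho}=\sigma$ if $2\leq\rho\leq\omega$). $I_{\kappa,\sigma}$ is the set of all $A\subseteq P_\kappa(\sigma)$ such that $\{a\in A: b\subseteq a\}=\emptyset$ for some $b\in P_\kappa(\sigma)$. An ideal on $P_\kappa(\sigma)$ is a collection $J$ of subsets of $P_\kappa(\sigma)$ such that $I_{\kappa,\sigma}\subseteq J$; $P_\kappa(\sigma)\notin J$; every subset of a member of $J$ is in $J$; and $\bigcup X\in J$ for every $X\in P_\kappa(J)$. Put $J^+=\{A\subseteq P_\kappa(\sigma):A\notin J\}$, $J^*=\{A\subseteq P_\kappa(\sigma): P_\kappa(\sigma)\setminus A\in J\}$, and, for $A\in J^+$, $J\mid A=\{B\subseteq P_\kappa(\sigma): B\cap A\in J\}$. $\overline{\mathrm{cof}}(J)$ is the least size of any $Y\subseteq J$ such that for every $A\in J$ there is $y\in P_\kappa(Y)$ with $A\subseteq\bigcup y$. For an infinite cardinal $\mu\leq\sigma$, an ideal $J$ on $P_\kappa(\sigma)$ is $\mu$-normal if for every $A\in J^+$ and every $f:A\to\mu$ with $f(a)\in a$ for all $a\in A$, there is $B\in J^+$, $B\subseteq A$, with $f$ constant on $B$. $NS_{\kappa,\sigma}^\mu$ is the smallest $\mu$-normal ideal on $P_\kappa(\sigma)$.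 For cardinals $1\leq\mu\leq\sigma$ and $2\leq\theta\leq\kappa$, an ideal $J$ on $P_\kappa(\sigma)$ is $[\mu]^{<\theta}$-normal if for every $A\in J^+$ and every $f:A\to P_\theta(\mu)$ with $f(a)\in P_{|a\cap\theta|}(a\cap\mu)$ for all $a\in A$, there is $B\in J^+$, $B\subseteq A$, with $f$ constant on $B$. If there is such an ideal, $NS_{\kappa,\sigma}^{[\mu]^{<\theta}}$ denotes the smallest one. $\overline\theta=\theta$ if $\theta<\kappa$, or if $\theta=\kappa$ and $\kappa$ is a limit cardinal; $\overline\theta=\nu$ if $\theta=\kappa=\nu^+$. *)

(* Defs.v *)
From mathcomp Require Import all_boot all_order.
From mathcomp Require Import boolp classical_sets functions cardinality.
From mathcomp Require wochoice.

Set Implicit Arguments.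
Unset Strict Implicit.
Unset Printing Implicit Defensive.

Local Open Scope classical_set_scope.
Local Open Scope card_scope.

Definition card_lt T U (A : set T) (B : set U) : Prop :=
  A #<= B /\ ~ (B #<= A).

(* $P_\rho(X)$, where the cardinal $\rho$ is the cardinality of R. *)
Definition Psub T U (R : set U) (X : set T) : set (set T) :=
  [set a | a `<=` X /\ card_lt a R].

Section Ordinals.
(* The elements of a well-ordered type O are the ordinals of an initial segment
   of the class of ordinals; an ordinal x is identified with seg x, the set of
   the smaller ordinals. *)
Context {d : Order.disp_t} {O : orderType d}.
Implicit Types (x y kappa lambda sigma theta mu nu rho : O).

Definition seg x : set O := [set y | (y < x)%O].

Definition is_card x : Prop := forall y, (y < x)%O -> card_lt (seg y) (seg x).

Definition infinite_card x : Prop := is_card x /\ infinite_set (seg x).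

Definition cofinal x (X : set O) : Prop :=
  X `<=` seg x /\ forall y, (y < x)%O -> exists2 z, X z & (y <= z)%O.

(* mu = cf(x) *)
Definition is_cf x mu : Prop :=
  [/\ is_card mu,
      exists2 X, cofinal x X & X #= seg mu
    & forall X, cofinal x X -> seg mu #<= X].

Definition regular x : Prop := infinite_card x /\ is_cf x x.

Definition singular x : Prop :=
  infinite_card x /\ exists2 mu, is_cf x mu & (mu < x)%O.

(* mu = nu^+ *)
Definition is_succ_card nu mu : Prop :=
  [/\ is_card mu, (nu < mu)%O
    & forall rho, is_card rho -> (nu < rho)%O -> (mu <= rho)%O].

Definition limit_card x : Prop :=
  infinite_card x /\ ~ exists2 nu, is_card nu & is_succ_card nu x.

(* rho = \overline{theta} *)
Definition is_bar kappa theta rho : Prop :=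
  ((theta < kappa)%O /\ rho = theta) \/
  (theta = kappa /\ limit_card kappa /\ rho = theta) \/
  (theta = kappa /\ is_card rho /\ is_succ_card rho kappa).

Definition PP kappa sigma : set (set O) := Psub (seg kappa) (seg sigma).

(* $I_{\kappa,\sigma}$ *)
Definition nonunbounded kappa sigma : set (set (set O)) :=
  [set A | A `<=` PP kappa sigma /\
     exists2 b, PP kappa sigma b & [set a | A a /\ b `<=` a] = set0].

Record ideal kappa sigma (J : set (set (set O))) : Prop := {
  ideal_sub : forall A, J A -> A `<=` PP kappa sigma ;
  ideal_nonunbounded : nonunbounded kappa sigma `<=` J ;
  ideal_proper : ~ J (PP kappa sigma) ;
  ideal_down : forall A B, J A -> B `<=` A -> J B ;
  ideal_complete : forall X, Psub (seg kappa) J X -> J (\bigcup_(A in X) A) }.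

(* $J^+$ *)
Definition positive kappa sigma (J : set (set (set O))) : set (set (set O)) :=
  [set A | A `<=` PP kappa sigma /\ ~ J A].

(* $J^*$ *)
Definition dual_filter kappa sigma (J : set (set (set O))) : set (set (set O)) :=
  [set A | A `<=` PP kappa sigma /\ J (PP kappa sigma `\` A)].

(* $J \mid A$ *)
Definition ideal_restr kappa sigma (J : set (set (set O))) (A : set (set O)) :
    set (set (set O)) :=
  [set B | B `<=` PP kappa sigma /\ J (B `&` A)].

Definition cof_bar_base kappa (J Y : set (set (set O))) : Prop :=
  Y `<=` J /\ forall A, J A ->
    exists2 y, Psub (seg kappa) Y y & A `<=` \bigcup_(B in y) B.

(* $\overline{\mathrm{cof}}(J)\leq |S|$: the least size of a base in the above
   sense is the cardinality of Y. *)
Definition cof_bar_le U kappa (J : set (set (set O))) (S : set U) : Prop :=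
  exists Y, [/\ cof_bar_base kappa J Y,
                forall Z, cof_bar_base kappa J Z -> Y #<= Z
              & Y #<= S].

Definition normal kappa sigma mu (J : set (set (set O))) : Prop :=
  forall (A : set (set O)) (f : set O -> O),
    positive kappa sigma J A ->
    (forall a, A a -> seg mu (f a) /\ a (f a)) ->
    exists B, [/\ positive kappa sigma J B, B `<=` A
                & exists c, forall b, B b -> f b = c].

(* $[\mu]^{<\theta}$-normality *)
Definition bnormal kappa sigma mu theta (J : set (set (set O))) : Prop :=
  forall (A : set (set O)) (f : set O -> set O),
    positive kappa sigma J A ->
    (forall a, A a -> Psub (seg theta) (seg mu) (f a) /\
                      Psub (a `&` seg theta) (a `&` seg mu) (f a)) ->
    exists B, [/\ positive kappa sigma J B, B `<=` A
                & exists c, forall b, B b -> f b = c].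

(* Every ideal contains nonunbounded, so "smallest such ideal including it"
   below just means "smallest such ideal". *)

(* $NS_{\kappa,\sigma}^\mu$ *)
Definition NS kappa sigma mu : set (set (set O)) :=
  smallest [set J | ideal kappa sigma J /\ normal kappa sigma mu J]
           (nonunbounded kappa sigma).

Definition bnormal_ideal kappa sigma mu theta (J : set (set (set O))) : Prop :=
  ideal kappa sigma J /\ bnormal kappa sigma mu theta J.

(* $NS_{\kappa,\sigma}^{[\mu]^{<\theta}}$; meaningful only if some
   $[\mu]^{<\theta}$-normal ideal exists. *)
Definition bNS kappa sigma mu theta : set (set (set O)) :=
  smallest (bnormal_ideal kappa sigma mu theta) (nonunbounded kappa sigma).

End Ordinals.

(* Main.v *)
Require Import Defs.
From Stdlib Require Import Relation_Operators Wellfounded.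
From mathcomp Require Import all_boot all_order.
From mathcomp Require Import boolp classical_sets functions cardinality.
From mathcomp Require wochoice.

(** Write mu = cf(lambda), let M be NS_{kappa,lambda}^mu and let N be
NS_{kappa,lambda}^{[lambda]^{<theta}}.  Fix cardinals tau_i (i < mu) cofinal in
lambda, and put J_i = NS_{kappa,tau_i}^{[delta_i]^{<theta}}, where
delta_i = tau_i for (i) and delta_i = chi for (ii).  The cofinality hypothesis
turns into a map g_i from P_thetabar(lambda) to J_i such that every member of
J_i is covered by fewer than kappa sets g_i(e) ([bNS_covers]).  Let A
([avoiding]) be the set of those a such that the trace of a on tau_i lies
outside g_i(e) for all i in a and all small e included in a.

A is in the dual of N ([avoiding_dual]): the members of J_i, pulled back
along the trace map, are in N ([bnormal_proj]), so what A omits is a diagonal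
union of sets in N.

The point is that, on A, the smaller ideal M controls all the J_i at once
([bounded_diagU_null]).  A set V in J_i is covered by g_i(e) for e in a family x
of fewer than kappa sets; the union c of x, slightly enlarged, is in
P_kappa(lambda), and if a in A contains i and includes c, then the trace of a
on tau_i is not in V.  So avoiding a set V_i of J_i for every i in a at the same
time costs only the condition that c_i is included in a for all i in a, which
is a mu-normal condition.

This makes M|A normal for small sets e.  Suppose that D(e), for each e included
in some eps below all relevant delta_i, is a subset of A that is in M.  A set in M
consists of sets a that are not closed under some finitary function K_e
from mu to P_kappa(lambda) ([NS_escapes]).  Cut K_e(s) into its parts below the
various tau_j, adding the indices j that are needed to cover K_e(s).  Closure
under the j-th part, for all small e at once, is a condition on the trace of a
on tau_j that holds outside a set of J_j, by normality of J_j
([bnormal_escapes]).  Hence, outside a set of M, every a in A is closed under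
K_e for all its small subsets e of eps, and so is in no D(e).

For (ii) take eps = chi: M|A is [chi]^{<theta}-normal, so it includes
NS_{kappa,lambda}^{[chi]^{<theta}}.  For (i), a small e has fewer than
cf(lambda) elements, so it is bounded by tau_i for some i = h(e).  The set A can
be shrunk so that its members are closed under h, and then mu-normality of M
reduces a diagonal union over all small e to those with e below a fixed tau_i.

The regularity of kappa enters through the given ideal: an ideal on
P_kappa(lambda) is proper and kappa-complete, hence P_kappa(lambda) is closed
under unions of fewer than kappa members ([PP_bigcup]).  Cardinal multiplication
is needed only to know that lambda, being singular, is a limit of cardinals
([singular_limit]). *)

Set Implicit Arguments.
Unset Strict Implicit.
Unset Printing Implicit Defensive.
Import Order.TTheory.
Local Open Scope classical_set_scope.
Local Open Scope card_scope.

(** * Comparing cardinalities *)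

Section Cardinality.
Context {T U : Type}.
Implicit Types (A : set T) (B : set U).

Lemma card_le_surj A B (x0 : T) : A #<= B -> exists g : U -> T, A `<=` g @` B.
Proof.
case/pfcard_geP => [->|/surjfunPex[g ->]]; last by exists g.
by exists (fun=> x0).
Qed.

Lemma card_le_inj A B (y0 : U) : A #<= B ->
  exists f : T -> U, (forall x, A x -> B (f x)) /\
    (forall x y, A x -> A y -> f x = f y -> x = y).
Proof.
case/pfcard_geP => [->|/surjfunPex[g AE]]; first by exists (fun=> y0).
have /choice[f fP] : forall x, exists y, A x -> B y /\ g y = x.
  move=> x; have [Ax|nAx] := pselect (A x); last by exists y0.
  by move: Ax; rewrite {1}AE => -[y By <-]; exists y.
exists f; split=> [x /fP[]//|x y /fP[_ {2}<-] /fP[_ {2}<-] ->//].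
Qed.

Lemma card_le_of_inj A B (f : T -> U) : (forall x, A x -> B (f x)) ->
  (forall x y, A x -> A y -> f x = f y -> x = y) -> A #<= B.
Proof.
move=> fB finj; have /card_eqPle[_ /card_le_trans] : f @` A #= A.
  by apply: inj_card_eq => x y /set_mem Ax /set_mem Ay; exact: finj.
by apply; apply: subset_card_le => _ [x Ax <-]; exact: fB.
Qed.

Lemma card_le_lt_trans V A B (C : set V) : A #<= B -> card_lt B C -> card_lt A C.
Proof.
move=> AB [BC nCB]; split; first exact: card_le_trans BC.
by move=> CA; apply: nCB; exact: card_le_trans AB.
Qed.

Lemma card_lt_le_trans V A B (C : set V) : card_lt A B -> B #<= C -> card_lt A C.
Proof.
move=> [AB nBA] BC; split; first exact: card_le_trans BC.
by move=> CA; apply: nBA; exact: card_le_trans CA.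
Qed.

End Cardinality.

(** Transfinite enumeration: send p to an element of X that is not the image of
a predecessor of p.  If X is too big to be exhausted by the predecessors of
any point, this never gets stuck. *)
Lemma card_le_rank T (U : choiceType) (r : T -> T -> Prop) (S : set T)
    (X : set U) (u0 : U) :
  well_founded r ->
  (forall p q, S p -> S q -> p <> q -> r p q \/ r q p) ->
  (forall p, S p -> ~ (X #<= [set q | S q /\ r q p])) -> S #<= X.
Proof.
move=> wfr tot small.
pose F p (rec : forall q, r q p -> U) : U :=
  xget u0 [set u | X u /\ forall q (rqp : r q p), S q -> rec q rqp <> u].
pose h := Fix wfr (fun=> U) F.
have hE p : h p = xget u0 [set u | X u /\ forall q, r q p -> S q -> h q <> u].
  rewrite /h Fix_eq // => {}p f g fg; congr xget.
  by have -> : f = g by do 2 apply: functional_extensionality_dep => ?.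
have hP p : S p -> X (h p) /\ forall q, r q p -> S q -> h q <> h p.
  move=> Sp; rewrite (hE p).
  apply: (@xgetPex _ u0 [set u | X u /\ forall q, r q p -> S q -> h q <> u]).
  apply: contrapT => none; apply: (small p Sp).
  apply: card_le_trans (card_image_le h _); apply: subset_card_le => u Xu.
  apply: contrapT => nu; apply: none; exists u; split=> // q rq Sq hq.
  by apply: nu; exists q.
apply: (card_le_of_inj (f := h)) => [x /hP[]//|x y Sx Sy hxy].
apply: contrapT => nxy; case: (tot x y Sx Sy nxy) => rxy.
  by case: (hP y Sy) => _ /(_ _ rxy Sx).
by case: (hP x Sx) => _ /(_ _ rxy Sy); rewrite hxy.
Qed.

(** * Cardinals in a well-ordered type *)

Section Ordinals.
Context {d : Order.disp_t} {O : orderType d}.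
Hypothesis wfO : wochoice.well_order (<=%O : rel O).
Implicit Types (x y z : O) (P : O -> Prop).

Lemma ex_least P : (exists x, P x) ->
  exists x, P x /\ forall y, (y < x)%O -> ~ P y.
Proof.
move=> [x Px]; case: (wfO (A := fun x => `[< P x >])).
  by exists x; apply/asboolP.
move=> z [[/asboolP Pz minz] _]; exists z; split=> // y yz Py.
by have := minz y; rewrite leNgt yz => /(_ (asboolT Py)).
Qed.

Lemma lt_wf : well_founded (fun x y => (x < y)%O).
Proof.
move=> x; apply: contrapT => nx.
have [y [ny miny]] := ex_least (ex_intro (fun x => ~ Acc _ x) x nx).
by apply: ny; constructor => z zy; apply: contrapT => nz; exact: miny nz.
Qed.

Lemma seg_le x y : (x <= y)%O -> seg x `<=` seg y.
Proof. by move=> xy z /= /lt_le_trans; apply. Qed.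

Lemma card_seg_le x y : (x <= y)%O -> seg x #<= seg y.
Proof. by move=> /seg_le/subset_card_le. Qed.

Lemma is_card_le x y : is_card x -> seg x #<= seg y -> (x <= y)%O.
Proof. by move=> cx xy; rewrite leNgt; apply/negP => /cx[_]; apply. Qed.

(** If no proper segment of x had a copy of a inside, the points below x could be
sent one after the other to distinct elements of a, by [card_le_rank]. *)
Lemma card_lt_seg T (a : set T) x : card_lt a (seg x) ->
  exists2 y, (y < x)%O & a #<= seg y.
Proof.
move=> [ax nxa]; apply: contrapT => none; apply: nxa.
case: (EM (exists t : T, True)) => [[t0 _]|noT]; last first.
  suff -> : seg x = set0 by [].
  rewrite -subset0 => y yx; apply: none; exists y => //.
  by apply: (card_le_of_inj (f := fun _ => y)) => t; case: noT; exists t.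
have [f [fa finj]] := card_le_inj x ax.
apply: (card_le_trans (B := f @` a)); last exact: card_image_le.
apply: (card_le_rank (r := fun x y => (x < y)%O) x) => [|p q _ _ /eqP|p px pa].
- exact: lt_wf.
- by rewrite neq_lt => /orP.
- apply: none; exists p => //.
  apply: card_le_trans (subset_card_le (_ : [set q | seg x q /\ (q < p)%O] `<=` _)).
    apply: card_le_trans pa.
    by apply: (card_le_of_inj (f := f)) => // t at_; exists t.
  by move=> q [].
Qed.

Lemma ex_card x : exists c, [/\ is_card c, (c <= x)%O & seg x #= seg c].
Proof.
have [c [xc minc]] := @ex_least (fun y => seg x #<= seg y) (ex_intro _ x (card_lexx _)).
have cx : (c <= x)%O by rewrite leNgt; apply/negP => /minc; apply; exact: card_lexx.
exists c; split=> //.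
  move=> y yc; split; first by apply: card_seg_le; exact: ltW.
  by move=> cy; apply: (minc y) => //; exact: card_le_trans cy.
by apply/card_eqPle; split=> //; exact: card_seg_le.
Qed.

(** Otherwise seg x would be seg y plus the point y, and shifting a copy of the
natural numbers inside seg y makes room for one more point. *)
Lemma infinite_card_limit x y : infinite_card x -> (y < x)%O ->
  exists2 z, (z < x)%O & (y < z)%O.
Proof.
move=> [cx infx] yx; apply: contrapT => none.
have xE : seg x `<=` seg y `|` [set y].
  move=> z zx; have [zy|yz|->] := ltgtP z y; [by left| |by right].
  by case: none; exists z.
have : infinite_set (seg y).
  move=> finy; apply: infx; apply: sub_finite_set xE _.
  by rewrite finite_setU; split.
move=> /infiniteP/(card_le_inj y)[i [iy iinj]].
case: (cx _ yx) => _; apply.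
pose f z := if pselect (exists n, z = i n) is left e then i (sval (cid e)).+1
  else if z == y then i 0%N else z.
have fi n : f (i n) = i n.+1.
  rewrite /f; case: pselect => [e|]; last by case; exists n.
  by by case: (cid e) => m /= /(iinj _ _ I I) ->.
have fn z : ~ (exists n, z = i n) -> f z = if z == y then i 0%N else z.
  by move=> ne; rewrite /f; case: pselect.
apply: (card_le_of_inj (f := f)) => [z /xE zE|z w zx wx].
  case: (EM (exists n, z = i n)) => [[n ->]|ne]; first by rewrite fi; exact: iy.
  rewrite fn//; case: eqP => [_|nzy]; first exact: iy.
  by case: zE => // /eqP; rewrite (introF eqP nzy).
case: (EM (exists n, z = i n)) => [[n ->]|nz];
  case: (EM (exists n, w = i n)) => [[m ->]|nw].
- by rewrite !fi => /(iinj _ _ I I) [->].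
- rewrite fi fn //; case: eqP => [_ /(iinj _ _ I I)//|_ e].
  by case: nw; exists n.+1.
- rewrite fi fn //; case: eqP => [_ /(iinj _ _ I I)//|_ e].
  by case: nz; exists m.+1.
- rewrite !fn//; case: eqP => [->|_]; case: eqP => [->|_] //.
    by move=> e; case: nw; exists 0%N.
  by move=> e; case: nz; exists 0%N.
Qed.

(** Goedel's well-ordering of pairs, by maximum and then lexicographically: the
predecessors of a pair below a cardinal x form a subset of a square of smaller
cardinality, so [card_le_rank] embeds the square of seg x into seg x. *)
Lemma hessenberg x : infinite_set (seg x) -> seg x `*` seg x #<= seg x.
Proof.
elim/(well_founded_ind lt_wf): x => x IH infx.
have [c [cc cx xc]] := ex_card x.
have [ltcx|ecx] : (c < x)%O \/ c = x
  by move: cx; rewrite le_eqVlt => /orP[/eqP|]; [right|left].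
  have /IH : infinite_set (seg c).
    by move=> finc; apply: infx; apply: card_le_finite finc; case/card_eqPle: xc.
  move=> /(_ ltcx) hc; case/card_eqPle: xc => xc cx'.
  apply: card_le_trans cx'; apply: card_le_trans hc.
  have [f [fc finj]] := card_le_inj x xc.
  apply: (card_le_of_inj (f := fun p => (f p.1, f p.2))) => [p []|].
    by split; exact: fc.
  by move=> [p1 p2] [q1 q2] [/= ? ?] [/= ? ?] [/finj -> // /finj ->].
subst c; have infcx : infinite_card x by [].
pose lex := slexprod O (O * O) (fun x y => (x < y)%O)
  (slexprod O O (fun x y => (x < y)%O) (fun x y => (x < y)%O)).
pose mx (p : O * O) : O := Order.max p.1 p.2.
pose key (p : O * O) := (mx p, (p.1, p.2)).
have wflex : well_founded lex by do 2 ?apply: wf_slexprod; exact: lt_wf.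
have lex_le u v : lex u v -> (u.1 <= v.1)%O by case=> /= [? ? ? ? /ltW|].
apply: (card_le_rank (r := fun p q => lex (key p) (key q)) x).
- exact: wf_inverse_image.
- move=> p q _ _ npq; rewrite /lex /key.
  have [h|h|h] := ltgtP (mx p) (mx q); [by left; left|by right; left|rewrite h].
  have [h1|h1|h1] := ltgtP p.1 q.1.
  + by left; right; left.
  + by right; right; left.
  have [h2|h2|h2] := ltgtP p.2 q.2.
  + by left; right; rewrite h1; right.
  + by right; right; rewrite h1; right.
  by case: npq; case: p q h1 h2 {h} => [? ?] [? ?] /= -> ->.
move=> p [p1 p2] big.
have mpx : (mx p < x)%O by rewrite /mx gt_max; apply/andP.
have [m mx' pm] := infinite_card_limit infcx mpx.
have xm : seg x #<= seg m `*` seg m.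
  apply: card_le_trans big _; apply: subset_card_le => q [_ lq].
  have : (mx q <= mx p)%O := lex_le _ _ lq.
  rewrite /mx ge_max => /andP[q1 q2].
  by split=> /=; [apply: le_lt_trans q1 pm|apply: le_lt_trans q2 pm].
have infm : infinite_set (seg m).
  by move=> finm; apply: infx; apply: (card_le_finite xm); exact: finite_setX.
case: (cc _ mx') => _; apply; apply: card_le_trans xm _; exact: IH.
Qed.

(** If there were no cardinal in [x, lambda), then all y < lambda would have
size at most |x|, and lambda would be a union of cf(lambda) sets of size at most
|x|, which is too small by [hessenberg]. *)
Lemma singular_limit lambda x : singular lambda -> (x < lambda)%O ->
  exists c, [/\ is_card c, (x <= c)%O & (c < lambda)%O].
Proof.
move=> [[cl infl] [mu [cmu [X [Xl Xcof] Xmu] _] mul]] xl.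
apply: contrapT => none.
have small y : (y < lambda)%O -> seg y #<= seg x.
  move=> yl; have [c [cc cy yc]] := ex_card y.
  have cl' := le_lt_trans cy yl.
  have cx : (c <= x)%O.
    by rewrite leNgt; apply/negP => xc; apply: none; exists c; split=> //; exact: ltW.
  by move/card_eqPle: yc => [yc _]; apply: card_le_trans yc _; exact: card_seg_le.
pose m := Order.max x mu.
have ml : (m < lambda)%O by rewrite /m gt_max xl mul.
have inj y : exists f : O -> O, (y < lambda)%O -> (forall z, (z < y)%O -> (f z < x)%O) /\
     (forall z w, (z < y)%O -> (w < y)%O -> f z = f w -> z = w).
  have [yl|] := pselect (y < lambda)%O; last by exists id.
  by have [f [? ?]] := card_le_inj y (small y yl); exists f.
have {inj}[f fP] := choice inj.
case/card_eqPle: Xmu => /(card_le_inj x)[g [gX ginj]] _.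
have /choice[b bP] : forall y, exists z, (y < lambda)%O -> X z /\ (y < z)%O.
  move=> y; have [yl|] := pselect (y < lambda)%O; last by exists y.
  have [y' y'l yy'] := infinite_card_limit (conj cl infl) yl.
  by have [z Xz y'z] := Xcof _ y'l; exists z => _; split=> //; exact: lt_le_trans y'z.
(* y is coded by the index of a member b y of X above it and by the image of y
   under the injection of seg (b y) into seg x *)
have lm : seg lambda #<= seg m `*` seg m.
  apply: (card_le_of_inj (f := fun y => (g (b y), f (b y) y))) => [y yl|y z yl zl].
    have [Xb yb] := bP _ yl; have [fb _] := fP _ (Xl _ Xb).
    split; rewrite /seg /= /m lt_max ?fb //.
    by apply/orP; right; exact: gX.
  have [Xb yb] := bP _ yl; have [Xc zc] := bP _ zl.
  move=> [/ginj -/(_ Xb Xc) e]; rewrite -{}e in zc * => e.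
  by case: (fP _ (Xl _ Xb)) => _ /(_ y z yb zc e).
case: (cl _ ml) => _; apply; apply: (card_le_trans lm); apply: hessenberg => // finm.
by apply: infl; apply: (card_le_finite lm); exact: finite_setX.
Qed.

End Ordinals.

(** * Ideals on P_kappa(sigma) *)

Section Ideals.
Context {d : Order.disp_t} {O : orderType d}.
Variables (kappa sigma : O).
Hypothesis kappa_uncountable : ~ countable (seg kappa).
Implicit Types (a b e : set O) (J : set (set (set O))) (mu theta delta x : O).

Lemma countable_lt_kappa T (A : set T) : countable A -> card_lt A (seg kappa).
Proof.
move=> cA; apply: (card_le_lt_trans cA); split=> //.
by apply/infiniteP => /finite_set_countable.
Qed.

Lemma PP_sub a b : PP kappa sigma a -> b `<=` a -> PP kappa sigma b.
Proof.
move=> [asig ak] ba; split; first exact: subset_trans asig.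
exact: card_le_lt_trans (subset_card_le ba) ak.
Qed.

Lemma ideal_set0 J : ideal kappa sigma J -> J set0.
Proof.
move=> idJ; rewrite -(bigcup_set0 (fun A : set (set O) => A)).
apply: (ideal_complete idJ) => //; split=> //.
by apply: countable_lt_kappa; exact: countable0.
Qed.

Lemma ideal_bigcup J T (I : set T) F : ideal kappa sigma J ->
  card_lt I (seg kappa) -> (forall i, I i -> J (F i)) ->
  J (\bigcup_(i in I) F i).
Proof.
move=> idJ Ik JF.
have -> : \bigcup_(i in I) F i = \bigcup_(A in F @` I) A.
  by rewrite bigcup_image.
apply: (ideal_complete idJ) => //; split; first by move=> _ [i /JF ? <-].
exact: card_le_lt_trans (card_image_le _ _) Ik.
Qed.

Lemma ideal_setU J A B : ideal kappa sigma J -> J A -> J B -> J (A `|` B).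
Proof.
move=> idJ JA JB; rewrite -bigcup2E; apply: ideal_bigcup => // [|i _].
  exact: countable_lt_kappa.
by case: i => [|[|i]] //=; exact: ideal_set0.
Qed.

Lemma ideal_not_superset J b : ideal kappa sigma J -> PP kappa sigma b ->
  J [set a | PP kappa sigma a /\ ~ b `<=` a].
Proof.
move=> idJ PPb; apply: (ideal_nonunbounded idJ); split=> [a []//|].
by exists b => //; rewrite -subset0 => a [[]].
Qed.

Lemma ideal_proper_ex J A : ideal kappa sigma J -> J A ->
  exists2 a, PP kappa sigma a & ~ A a.
Proof.
move=> idJ JA; apply: contrapT => none; apply: (ideal_proper idJ).
apply: (ideal_down idJ JA) => a PPa; apply: contrapT => nAa.
by apply: none; exists a.
Qed.

(** A proper kappa-complete ideal misses some a that includes all the F i, so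
the union is no bigger than a; this replaces an appeal to the regularity of
kappa. *)
Lemma PP_bigcup J T (I : set T) F : ideal kappa sigma J ->
  card_lt I (seg kappa) -> (forall i, I i -> PP kappa sigma (F i)) ->
  PP kappa sigma (\bigcup_(i in I) F i).
Proof.
move=> idJ Ik PF.
have [a PPa aF] : exists2 a, PP kappa sigma a &
    ~ (\bigcup_(i in I) [set a | PP kappa sigma a /\ ~ F i `<=` a]) a.
  apply: ideal_proper_ex (idJ) _; apply: ideal_bigcup => // i /PF.
  exact: ideal_not_superset.
apply: (PP_sub PPa) => x [i Ii Fx]; apply: contrapT => nax.
by apply: aF; exists i => //; split=> // /(_ x Fx).
Qed.

Lemma PP_setU J a b : ideal kappa sigma J -> PP kappa sigma a ->
  PP kappa sigma b -> PP kappa sigma (a `|` b).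
Proof.
move=> idJ Pa Pb; rewrite -bigcup2E; apply: (PP_bigcup idJ) => [|i _].
  exact: countable_lt_kappa.
by case: i => [|[|i]] //=; exact: PP_sub Pa _.
Qed.

(** * Normality in terms of diagonal unions *)

Definition admissible theta a e := e `<=` a /\ card_lt e (a `&` seg theta).

Definition diagU mu (D : O -> set (set O)) : set (set O) :=
  [set a | PP kappa sigma a /\ exists x, [/\ seg mu x, a x & D x a]].

Definition bdiagU mu theta (D : set O -> set (set O)) : set (set O) :=
  [set a | PP kappa sigma a /\
     exists e, [/\ e `<=` seg mu, admissible theta a e & D e a]].

Lemma normalP mu J : ideal kappa sigma J -> normal kappa sigma mu J <->
  forall D, (forall x, seg mu x -> J (D x)) -> J (diagU mu D).
Proof.
move=> idJ; split=> [nJ D JD|dJ A f [APP nJA] fA].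
  apply: contrapT => nJ_D.
  have /choice[f fP] : forall a, exists x,
      diagU mu D a -> [/\ seg mu x, a x & D x a].
    move=> a; have [[_ [x xP]]|na] := pselect (diagU mu D a); first by exists x.
    by exists kappa.
  have [||B [[BPP nJB] BD [c fc]]] := nJ (diagU mu D) f.
  - by split=> // a [].
  - by move=> a /fP[].
  apply: nJB; have [[b Bb]|B0] := pselect (exists b, B b); last first.
    by apply: (ideal_down idJ (ideal_set0 idJ)) => b Bb; apply: B0; exists b.
  have cmu : seg mu c by have [+ _ _] := fP _ (BD _ Bb); rewrite (fc _ Bb).
  apply: (ideal_down idJ (JD _ cmu)) => a Ba.
  by rewrite -(fc _ Ba); case: (fP _ (BD _ Ba)).
apply: contrapT => none; apply: nJA.
apply: (ideal_down idJ (dJ (fun x => [set a | A a /\ f a = x]) _)).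
  move=> x _; apply: contrapT => nJx; apply: none.
  exists [set a | A a /\ f a = x]; split=> [|a []//|]; last by exists x => a [].
  by split=> // a [/APP].
by move=> a Aa; have [? ?] := fA _ Aa; split; [exact: APP|exists (f a)].
Qed.

Lemma bnormalP mu theta J : ideal kappa sigma J ->
  bnormal kappa sigma mu theta J <->
  forall D, (forall e, e `<=` seg mu -> J (D e)) -> J (bdiagU mu theta D).
Proof.
move=> idJ; split=> [nJ D JD|dJ A f [APP nJA] fA].
  apply: contrapT => nJ_D.
  have /choice[f fP] : forall a, exists e,
      bdiagU mu theta D a -> [/\ e `<=` seg mu, admissible theta a e & D e a].
    move=> a; have [[_ [e eP]]|na] := pselect (bdiagU mu theta D a); first by exists e.
    by exists set0.
  have [||B [[BPP nJB] BD [c fc]]] := nJ (bdiagU mu theta D) f.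
  - by split=> // a [].
  - move=> a /fP[fmu [fa lta] _]; split; split=> //.
      by apply: (card_lt_le_trans lta); apply: subset_card_le => x [].
    by move=> x fx; split; [exact: fa|exact: fmu].
  apply: nJB; have [[b Bb]|B0] := pselect (exists b, B b); last first.
    by apply: (ideal_down idJ (ideal_set0 idJ)) => b Bb; apply: B0; exists b.
  have cmu : c `<=` seg mu by have [+ _ _] := fP _ (BD _ Bb); rewrite (fc _ Bb).
  apply: (ideal_down idJ (JD _ cmu)) => a Ba.
  by rewrite -(fc _ Ba); case: (fP _ (BD _ Ba)).
apply: contrapT => none; apply: nJA.
apply: (ideal_down idJ (dJ (fun e => [set a | A a /\ f a = e]) _)).
  move=> e _; apply: contrapT => nJe; apply: none.
  exists [set a | A a /\ f a = e]; split=> [|a []//|]; last by exists e => a [].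
  by split=> // a [/APP].
move=> a Aa; have [[fmu _] [fa fltt]] := fA _ Aa.
split; [exact: APP|exists (f a); split=> //]; split=> // x /fa[] //.
Qed.

(** * The smallest normal ideals *)

Lemma smallest_ideal (P : set (set (set (set O)))) :
  (exists J, ideal kappa sigma J /\ P J) ->
  ideal kappa sigma
    (smallest [set J | ideal kappa sigma J /\ P J] (nonunbounded kappa sigma)).
Proof.
move=> [J0 [idJ0 PJ0]].
have JI J : ideal kappa sigma J /\ P J ->
    [set M | [set J | ideal kappa sigma J /\ P J] M /\ nonunbounded kappa sigma `<=` M] J.
  by move=> [idJ PJ]; split=> //; exact: (ideal_nonunbounded idJ).
split.
- by move=> A /(_ J0 (JI _ (conj idJ0 PJ0))) /(ideal_sub idJ0).
- by move=> A nA J [_]; apply.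
- by move=> /(_ J0 (JI _ (conj idJ0 PJ0))); exact: ideal_proper idJ0.
- by move=> A B SA BA J JC; apply: (ideal_down JC.1.1 (SA _ JC)).
- move=> X [XS Xk] J JC; apply: (ideal_complete JC.1.1); split=> // A /XS.
  exact.
Qed.

Lemma NS_sub mu J : ideal kappa sigma J -> normal kappa sigma mu J ->
  NS kappa sigma mu `<=` J.
Proof. by move=> idJ nJ; apply: smallest_sub => //; exact: ideal_nonunbounded idJ. Qed.

Lemma bNS_sub mu theta J : bnormal_ideal kappa sigma mu theta J ->
  bNS kappa sigma mu theta `<=` J.
Proof. by move=> idJ; apply: smallest_sub => //; exact: ideal_nonunbounded idJ.1. Qed.

Lemma NS_normal mu : (exists J, ideal kappa sigma J /\ normal kappa sigma mu J) ->
  ideal kappa sigma (NS kappa sigma mu) /\ normal kappa sigma mu (NS kappa sigma mu).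
Proof.
move=> ex; have idM := smallest_ideal ex; split=> //.
apply/(normalP _ idM) => D DM J JC; have [[idJ nJ] _] := JC.
by move/(normalP _ idJ): nJ; apply => x /DM; exact.
Qed.

Lemma bNS_bnormal mu theta : (exists J, bnormal_ideal kappa sigma mu theta J) ->
  bnormal_ideal kappa sigma mu theta (bNS kappa sigma mu theta).
Proof.
move=> ex; have idM := smallest_ideal ex; split=> //.
apply/(bnormalP _ _ idM) => D DM J JC; have [[idJ nJ] _] := JC.
by move/(bnormalP _ _ idJ): nJ; apply => x /DM; exact.
Qed.

Lemma bnormal_le mu delta theta J : (mu <= delta)%O ->
  bnormal_ideal kappa sigma delta theta J -> bnormal_ideal kappa sigma mu theta J.
Proof.
move=> md [idJ nJ]; split=> //; apply/(bnormalP _ _ idJ) => D JD.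
have /(bnormalP _ _ idJ) {}nJ := nJ.
apply: (ideal_down idJ (nJ (fun e => [set a | e `<=` seg mu /\ D e a]) _)).
  move=> e _; have [emu|nemu] := pselect (e `<=` seg mu).
    by apply: (ideal_down idJ (JD _ emu)) => a [].
  by apply: (ideal_down idJ (ideal_set0 idJ)) => a [].
move=> a [PPa [e [emu ae De]]]; split=> //; exists e; split=> //.
by move=> x /emu; exact: seg_le.
Qed.

(** A regressive ordinal x is the small set {x}, admissible as soon as a
contains two elements of theta. *)
Lemma bnormal_normal mu theta J : `I_2 #<= seg theta -> (theta <= kappa)%O ->
  (kappa <= sigma)%O ->
  bnormal_ideal kappa sigma mu theta J -> normal kappa sigma mu J.
Proof.
move=> th2 thk ks [idJ nJ]; apply/(normalP _ idJ) => D JD.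
have /(bnormalP _ _ idJ) {}nJ := nJ.
have [t [tth tinj]] := card_le_inj kappa th2.
pose b := [set t 0%N; t 1%N].
have bth : b `<=` seg theta by move=> x [->|->]; exact: tth.
have PPb : PP kappa sigma b.
  split; first by move=> x /bth; apply: seg_le; exact: le_trans ks.
  by apply: countable_lt_kappa; apply: finite_set_countable; exact: finite_set2.
have Jb := ideal_not_superset idJ PPb.
apply: (ideal_down idJ (ideal_setU idJ Jb
  (nJ (fun e => [set a | exists x, [/\ e = [set x], seg mu x & D x a]]) _))).
  move=> e _; have [[x ex]|ne] := pselect (exists x, e = [set x] /\ seg mu x).
    apply: (ideal_down idJ (JD x ex.2)) => a [y [ey _ Dy]].
    by have -> : x = y by have : [set x] y by rewrite -ex.1 ey.
  by apply: (ideal_down idJ (ideal_set0 idJ)) => a [x [? ? ?]]; apply: ne; exists x.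
move=> a [PPa [x [xmu ax Dx]]].
have [ba|nba] := pselect (b `<=` a); [right|by left].
split=> //; exists [set x]; split; [by move=> _ ->| |by exists x].
split; first by move=> _ ->.
have ca y : (a `&` seg theta) y -> [set x] #<= a `&` seg theta.
  by move=> ty; apply: (card_le_of_inj (f := fun=> y)) => // ? ? -> ->.
split.
  by apply: (ca (t 0%N)); split; [apply: ba; left|exact: tth].
move=> /(card_le_inj x)[f [fx finj]].
suff /tinj : t 0%N = t 1%N by move=> /(_ isT isT).
apply: finj; [by split; [apply: ba; left|exact: tth]| |].
  by split; [apply: ba; right|exact: tth].
rewrite (fx (t 0%N)) ?(fx (t 1%N)) //.
  by split; [apply: ba; right|exact: tth].
by split; [apply: ba; left|exact: tth].
Qed.

(** * Closure under finitary functions *)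

(** The arguments of K form a sequence of arbitrary length, so that a family of
functions K_x becomes a single one by prefixing the argument x. *)
Definition escapes mu (K : seq O -> set O) a :=
  exists2 s : seq O, (forall x, x \in s -> seg mu x /\ a x) & ~ K s `<=` a.

(** For a fixed number of arguments, the elements escaping form an iterated
diagonal union; there are countably many numbers of arguments, and kappa is
uncountable. *)
Lemma normal_escapes mu J K : ideal kappa sigma J -> normal kappa sigma mu J ->
  (forall s, PP kappa sigma (K s)) ->
  J [set a | PP kappa sigma a /\ escapes mu K a].
Proof.
move=> idJ /(normalP _ idJ) nJ.
pose E n K := [set a | PP kappa sigma a /\ exists s : seq O,
  [/\ size s = n, forall x, x \in s -> seg mu x /\ a x & ~ K s `<=` a]].
have JE n : forall K, (forall s, PP kappa sigma (K s)) -> J (E n K).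
  elim: n => [|n IH] {}K PK.
    apply: (ideal_down idJ (ideal_not_superset idJ (PK [::]))).
    by move=> a [PPa [s [/size0nil -> _ nK]]].
  apply: (ideal_down idJ (nJ (fun x => E n (fun s => K (x :: s))) _)).
    by move=> x _; exact: IH.
  move=> a [PPa [[//|x s] [[sn] sa nK]]]; split=> //.
  have [xmu ax] := sa x (mem_head _ _); exists x; split=> //; split=> //.
  by exists s; split=> // y ys; apply: sa; rewrite inE ys orbT.
move=> PK.
apply: (ideal_down idJ (ideal_bigcup (I := [set: nat]) (F := fun n => E n K) idJ _ _)).
- exact: countable_lt_kappa.
- by move=> n _; exact: JE.
by move=> a [PPa [s sa nK]]; exists (size s) => //; split=> //; exists s.
Qed.

Lemma bnormal_escapes mu delta theta J K :
  `I_2 #<= seg theta -> (theta <= kappa)%O -> (kappa <= sigma)%O ->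
  (mu <= delta)%O -> bnormal_ideal kappa sigma delta theta J ->
  (forall e s, PP kappa sigma (K e s)) ->
  J (bdiagU delta theta (fun e => [set a | PP kappa sigma a /\ escapes mu (K e) a])).
Proof.
move=> th2 thk ks md bJ PK.
have nJ : normal kappa sigma mu J by apply: bnormal_normal (bnormal_le md bJ).
by case: bJ nJ => idJ /(bnormalP _ _ idJ) bJ nJ; apply: bJ => e _; exact: normal_escapes.
Qed.

(** The sets all of whose elements escape some K form a mu-normal ideal E:
properness holds because E is included in the given J, and a diagonal union of
the sets escaping K_x escapes the function taking x, s to K_x(s). *)
Lemma NS_escapes mu J A : ideal kappa sigma J -> normal kappa sigma mu J ->
  NS kappa sigma mu A -> exists K, (forall s, PP kappa sigma (K s)) /\
    forall a, A a -> escapes mu K a.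
Proof.
move=> idJ nJ.
pose E := [set A | A `<=` PP kappa sigma /\ exists K,
  (forall s, PP kappa sigma (K s)) /\ forall a, A a -> escapes mu K a].
have PP0 : PP kappa sigma set0.
  by split=> //; apply: countable_lt_kappa; exact: countable0.
suff [idE nE] : ideal kappa sigma E /\ normal kappa sigma mu E.
  by move=> /(NS_sub idE nE)[].
have idE : ideal kappa sigma E.
  split.
  - by move=> B [].
  - move=> B [BPP [b PPb Bb]]; split=> //; exists (fun=> b); split=> // a Ba.
    by exists [::] => // ba; have : [set a | B a /\ b `<=` a] a by []; rewrite Bb.
  - move=> [_ [K [PK Kesc]]]; apply: (ideal_proper idJ).
    apply: (ideal_down idJ (normal_escapes idJ nJ PK)) => a PPa.
    by split=> //; exact: Kesc.
  - move=> B C [BPP [K [PK Kesc]]] CB; split; first exact: subset_trans BPP.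
    by exists K; split=> // a /CB; exact: Kesc.
  - move=> X [XE Xk]; split; first by move=> a [B /XE[+ _]]; apply.
    have /choice[K KP] : forall B, exists K, X B ->
        (forall s, PP kappa sigma (K s)) /\ forall a, B a -> escapes mu K a.
      move=> B; have [/XE[_ [K KP]]|nX] := pselect (X B); first by exists K.
      by exists (fun=> set0).
    exists (fun s => \bigcup_(B in X) K B s); split=> [s|a [B XB Ba]].
      by apply: (PP_bigcup idJ Xk) => B /KP[].
    have [_ /(_ a Ba)[s sa nK]] := KP _ XB.
    by exists s => // Ka; apply: nK => x Kx; apply: Ka; exists B.
split=> //; apply/(normalP _ idE) => D ED; split; first by move=> a [].
have /choice[K KP] : forall x, exists K, (forall s, PP kappa sigma (K s)) /\
    (seg mu x -> forall a, D x a -> escapes mu K a).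
  move=> x; have [/ED[_ [K [? ?]]]|nx] := pselect (seg mu x); first by exists K.
  by exists (fun=> set0).
exists (fun s => if s is x :: s' then K x s' else set0); split=> [[|x s] //|a].
  by have [] := KP x.
move=> [PPa [x [xmu ax Dx]]]; have [_ /(_ xmu a Dx)[s sa nK]] := KP x.
exists (x :: s) => // y; rewrite inE => /orP[/eqP -> //|]; exact: sa.
Qed.

(** * Restricting and projecting ideals *)

Lemma restr_ideal J A : ideal kappa sigma J -> A `<=` PP kappa sigma -> ~ J A ->
  ideal kappa sigma (ideal_restr kappa sigma J A).
Proof.
move=> idJ APP nJA; split.
- by move=> B [].
- move=> B nB; split; first by case: nB.
  by apply: (ideal_down idJ (ideal_nonunbounded idJ nB)) => a [].
- by move=> [_]; rewrite setIidr.
- move=> B C [BPP JB] CB; split; first exact: subset_trans BPP.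
  by apply: (ideal_down idJ JB) => a [/CB].
- move=> X [XJ Xk]; split; first by move=> a [B /XJ[+ _]]; apply.
  by rewrite setI_bigcupl; apply: ideal_bigcup => // B /XJ[].
Qed.

End Ideals.

(** The image of J under the trace map from P_kappa(lambda) to P_kappa(tau). *)
Lemma bnormal_proj (d : Order.disp_t) (O : orderType d)
    (kappa lambda mu tau delta theta : O) J :
  ~ countable (seg kappa) -> (tau <= lambda)%O -> (delta <= mu)%O ->
  bnormal_ideal kappa lambda mu theta J ->
  bnormal_ideal kappa tau delta theta [set B | B `<=` PP kappa tau /\
    J [set a | PP kappa lambda a /\ B (a `&` seg tau)]].
Proof.
move=> unc tl dm bJ; have {dm bJ} [idJ nJ] := bnormal_le unc dm bJ.
have PPtau a : PP kappa lambda a -> PP kappa tau (a `&` seg tau).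
  move=> PPa; split; first by move=> x [].
  by have [_] := PP_sub PPa (@subIsetl _ a (seg tau)).
set Jtau := (X in bnormal_ideal _ _ _ _ X).
have idJt : ideal kappa tau Jtau.
  split.
  - by move=> B [].
  - move=> B [BPP [b [btau bk] Bb]]; split=> //.
    have PPb : PP kappa lambda b by split=> // x /btau; exact: seg_le.
    apply: (ideal_down idJ (ideal_not_superset idJ PPb)) => a [PPa Ba]; split=> // ba.
    have : [set a | B a /\ b `<=` a] (a `&` seg tau).
      by split=> // x bx; split; [exact: ba|exact: btau].
    by rewrite Bb.
  - move=> [_ JP]; apply: (ideal_proper idJ); apply: (ideal_down idJ JP) => a PPa.
    by split=> //; exact: PPtau.
  - move=> B C [BPP JB] CB; split; first exact: subset_trans BPP.
    by apply: (ideal_down idJ JB) => a [? /CB].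
  - move=> X [XJ Xk]; split; first by move=> a [B /XJ[+ _]]; apply.
    apply: (ideal_down idJ (ideal_bigcup (I := X)
      (F := fun B => [set a | PP kappa lambda a /\ B (a `&` seg tau)]) idJ Xk _)).
      by move=> B /XJ[].
    by move=> a [PPa [B XB Ba]]; exists B.
split=> //; apply/(bnormalP unc _ _ idJt) => D JD; split; first by move=> a [].
have /(bnormalP unc _ _ idJ) {}nJ := nJ.
apply: (ideal_down idJ (nJ (fun e =>
    [set a | PP kappa lambda a /\ D e (a `&` seg tau)]) _)).
  by move=> e /JD[].
move=> a [PPa [_ [e [ed [ea elt] De]]]]; split=> //; exists e; split=> //.
split; first by move=> x /ea[].
by apply: (card_lt_le_trans elt); apply: subset_card_le => x [[]].
Qed.

(** * The cardinal thetabar *)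

Section Bar.
Context {d : Order.disp_t} {O : orderType d}.
Hypothesis wfO : wochoice.well_order (<=%O : rel O).
Variables (kappa lambda theta thetabar : O).
Hypothesis kappa_uncountable : ~ countable (seg kappa).
Hypothesis kappa_card : is_card kappa.
Hypothesis kappa_lt_lambda : (kappa < lambda)%O.
Hypothesis theta_le_kappa : (theta <= kappa)%O.
Hypothesis thetabarE : is_bar kappa theta thetabar.

Lemma seg_PP x : (x < kappa)%O -> PP kappa lambda (seg x).
Proof.
move=> xk; split; last exact: kappa_card.
by apply: seg_le; apply/ltW; exact: lt_trans kappa_lt_lambda.
Qed.

Lemma card_le_pred nu T (a : set T) : is_succ_card nu kappa ->
  card_lt a (seg kappa) -> a #<= seg nu.
Proof.
move=> [_ _ kmin] /(card_lt_seg wfO)[y yk ay].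
have [c [cc cy /card_eqPle[yc _]]] := ex_card wfO y.
apply: (card_le_trans ay); apply: (card_le_trans yc); apply: card_seg_le.
rewrite leNgt; apply/negP => /(kmin _ cc) kc.
by have := le_lt_trans cy yk; rewrite ltNge kc.
Qed.

(** Together with [bar_admissible], this is what thetabar is for: a set admissible
for some a has size less than thetabar, and a set of size less than thetabar is
admissible for all a that include a suitable c. *)
Lemma admissible_bar a e : PP kappa lambda a -> admissible theta a e ->
  Psub (seg thetabar) (seg lambda) e.
Proof.
move=> [alam ak] [ea elt]; split; first exact: subset_trans alam.
case: thetabarE => [[_ ->]|[[thE [_ ->]]|[thE [_ succ]]]].
- by apply: (card_lt_le_trans elt); apply: subset_card_le => x [].
- by apply: (card_lt_le_trans elt); apply: subset_card_le => x [].
apply: (card_lt_le_trans elt).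
apply: (card_le_trans (subset_card_le (@subIsetl _ a (seg theta)))).
exact: card_le_pred.
Qed.

Lemma limit_card_lt T (e : set T) : limit_card kappa -> card_lt e (seg kappa) ->
  exists2 x, (x < kappa)%O & card_lt e (seg x).
Proof.
move=> [_ nsucc] /(card_lt_seg wfO)[y yk ey].
apply: contrapT => none; apply: nsucc.
have [c [cc cy /card_eqPle[yc _]]] := ex_card wfO y.
have ck := le_lt_trans cy yk.
exists c => //; split=> // rho crho crho'.
rewrite leNgt; apply/negP => rk; apply: none; exists rho => //.
apply: card_le_lt_trans (crho _ crho'); exact: card_le_trans ey yc.
Qed.

Lemma bar_admissible J e : ideal kappa lambda J ->
  Psub (seg thetabar) (seg lambda) e ->
  exists c, PP kappa lambda c /\
    forall a, PP kappa lambda a -> c `<=` a -> admissible theta a e.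
Proof.
move=> idJ [elam ebar].
have [x xk xe] : exists2 x, (x < kappa)%O & card_lt e (seg x `&` seg theta).
  case: thetabarE => [[thk E]|[[thE [lim E]]|[thE [_ [ck nuk _]]]]].
  - by exists theta => //; rewrite setIid -E.
  - rewrite E thE in ebar.
    have [x xk ex] := limit_card_lt lim ebar; exists x => //.
    by rewrite setIidl // thE; apply: seg_le; exact: ltW.
  by exists thetabar => //; rewrite setIidl // thE; apply: seg_le; exact: ltW.
have PPe : PP kappa lambda e.
  split=> //; apply: (card_le_lt_trans (B := seg x)); last exact: kappa_card.
  by apply: card_le_trans xe.1 _; apply: subset_card_le => y [].
exists (e `|` seg x); split; first exact: PP_setU (idJ) PPe (seg_PP xk).
move=> a _ ca; split; first by move=> y ey; apply: ca; left.
apply: (card_lt_le_trans xe); apply: subset_card_le => y [yx yth]; split=> //.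
by apply: ca; right.
Qed.

Lemma small_bounded mu e : is_cf lambda mu -> (thetabar <= mu)%O ->
  Psub (seg thetabar) (seg lambda) e ->
  exists2 y, (y < lambda)%O & forall z, e z -> (z < y)%O.
Proof.
move=> [_ _ cfmin] tm [elam [_ ebar]]; apply: contrapT => none; apply: ebar.
apply: (card_le_trans (card_seg_le tm)); apply: cfmin; split=> // y yl.
apply: contrapT => ny; apply: none; exists y => // z ez.
by rewrite ltNge; apply/negP => yz; apply: ny; exists z.
Qed.

End Bar.

(** The base of J, being of size at most |S|, is indexed by S; the indices of a
small subfamily form a small subset of S. *)
Lemma cof_bar_cover (d : Order.disp_t) (O : orderType d) (kappa : O)
    (J : set (set (set O)))
    (S : set (set O)) :
  J set0 -> cof_bar_le kappa J S ->
  exists g : set O -> set (set O), (forall e, J (g e)) /\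
    forall V, J V -> exists x, [/\ x `<=` S, card_lt x (seg kappa) &
      V `<=` \bigcup_(e in x) g e].
Proof.
move=> J0 [Y [[YJ Ybase] _ /(card_le_inj set0)[f [fS finj]]]].
pose g e := xget set0 [set B | Y B /\ f B = e].
have gf B : Y B -> g (f B) = B.
  move=> YB; rewrite /g; case: xgetP => [C _ [YC /finj]|/(_ B)]; first exact.
  by case.
exists g; split=> [e|V /Ybase[y [yY yk] Vy]].
  by rewrite /g; case: xgetP => [C _ [/YJ]|].
exists (f @` y); split=> [_ [B /yY /fS ? <-] //||].
  exact: card_le_lt_trans (card_image_le _ _) yk.
by move=> a /Vy[B yB Ba]; exists (f B); [exists B|rewrite gf //; exact: yY].
Qed.

(** * Reducing the ideals on P_kappa(tau_i) to a mu-normal condition *)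

Section Core.
Context {d : Order.disp_t} {O : orderType d}.
Variables (kappa lambda mu theta : O) (tau delta : O -> O).
Variables (S : set (set O)) (N : set (set (set O))) (g : O -> set O -> set (set O)).
Hypothesis kappa_uncountable : ~ countable (seg kappa).
Hypothesis kappa_lt_lambda : (kappa < lambda)%O.
Hypothesis theta_ge2 : `I_2 #<= seg theta.
Hypothesis theta_le_kappa : (theta <= kappa)%O.
Hypothesis mu_lt_lambda : (mu < lambda)%O.
Hypothesis tauP : forall i, (i < mu)%O ->
  [/\ (kappa <= tau i)%O, (tau i < lambda)%O, (mu <= delta i)%O & (delta i <= tau i)%O].
Hypothesis tau_cofinal : forall y, (y < lambda)%O ->
  exists2 i, (i < mu)%O & (y < tau i)%O.
Hypothesis bN : bnormal_ideal kappa lambda lambda theta N.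
Hypothesis S_admissible : forall e, S e -> exists c, PP kappa lambda c /\
    forall a, PP kappa lambda a -> c `<=` a -> admissible theta a e.
Hypothesis g_null : forall i e, (i < mu)%O -> bNS kappa (tau i) (delta i) theta (g i e).
Hypothesis g_cover : forall i V, (i < mu)%O ->
  bNS kappa (tau i) (delta i) theta V -> exists x, [/\ x `<=` S,
     card_lt x (seg kappa) & V `<=` \bigcup_(e in x) g i e].

Local Notation M := (NS kappa lambda mu).

Definition avoiding : set (set O) := [set a | PP kappa lambda a /\
  forall i, (i < mu)%O -> a i -> forall e, admissible theta a e ->
    ~ g i e (a `&` seg (tau i))].

Lemma N_normal : normal kappa lambda mu N.
Proof.
apply: (bnormal_normal kappa_uncountable theta_ge2 theta_le_kappa (ltW kappa_lt_lambda)).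
exact: bnormal_le (ltW mu_lt_lambda) bN.
Qed.

Lemma avoiding_dual : dual_filter kappa lambda N avoiding.
Proof.
split; first by move=> a [].
have [idN nN] := bN; move/(bnormalP kappa_uncountable _ _ idN): nN => nN.
have := N_normal => /(normalP kappa_uncountable _ idN) nN'.
apply: (ideal_down idN (nN (fun e => diagU kappa lambda mu (fun i =>
   [set a | PP kappa lambda a /\ g i e (a `&` seg (tau i))])) _)).
  move=> e _; apply: nN' => i imu; have [_ tl _ dt] := tauP imu.
  have dl : (delta i <= lambda)%O := ltW (le_lt_trans dt tl).
  by have [] := bNS_sub (bnormal_proj kappa_uncountable (ltW tl) dl bN) (g_null e imu).
move=> a [PPa na]; split=> //; apply: contrapT => none; apply: na; split=> //.
move=> i imu ai e ae ge.
apply: none; exists e; split=> //; last by split=> //; exists i.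
by case: ae => [ea _]; case: PPa => + _; exact: subset_trans.
Qed.

(** For a in [avoiding], the mu-normal condition that c j is included in a for
all j in a ensures that, when j is in a and tau i <= tau j, the trace of a on
tau j is not in the set V j of those b that escape one of the truncated
functions K' j e.  If moreover i is in a, then a is closed under K e for all e
included in eps and admissible for a, because every point of K e s lies below
tau j for an index j that the truncation puts into a; so a is in no such D e. *)
Lemma bounded_diagU_null A D eps i : A `<=` avoiding -> (i < mu)%O ->
  (forall j, (j < mu)%O -> (tau i <= tau j)%O -> (eps <= delta j)%O) ->
  (forall e, e `<=` seg eps -> M (D e `&` A)) ->
  M [set a | A a /\ exists e, [/\ e `<=` seg eps, admissible theta a e & D e a]].
Proof.
move=> Aav imu eps_le MD; have [idN _] := bN.
have [idM nM] : ideal kappa lambda M /\ normal kappa lambda mu M.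
  by apply: NS_normal => //; exists N; split=> //; exact: N_normal.
have /choice[K KP] : forall e, exists K, (forall s, PP kappa lambda (K s)) /\
    (e `<=` seg eps -> forall a, D e a -> A a -> escapes mu K a).
  move=> e; have [/MD|ne] := pselect (e `<=` seg eps); last first.
    exists (fun=> set0); split=> // _; split=> //.
    by apply: countable_lt_kappa => //; exact: countable0.
  move=> /(NS_escapes kappa_uncountable idN N_normal)[k [PPk kesc]].
  by exists k; split=> // _ a Da Aa; exact: kesc.
have PPK e s : PP kappa lambda (K e s) by have [] := KP e.
have /choice[jx jxP] : forall x, exists j, (x < lambda)%O ->
    [/\ (j < mu)%O, (x < tau j)%O & (tau i <= tau j)%O].
  move=> x; have [xl|] := pselect (x < lambda)%O; last by exists x.
  have [_ til _ _] := tauP imu.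
  have /tau_cofinal[j jmu] : (Order.max x (tau i) < lambda)%O by rewrite gt_max xl.
  by rewrite gt_max => /andP[xj ij]; exists j; split=> //; exact: ltW.
(* truncation of K below tau j, with the indices that cover all of K e s *)
pose K' j e s := (K e s `&` seg (tau j)) `|` jx @` (K e s).
have PPK' j e s : (j < mu)%O -> PP kappa (tau j) (K' j e s).
  move=> jmu; have [_ _ mud dt] := tauP jmu.
  have [Kl Kk] := PPK e s; split.
    move=> _ [[_ //]|[x Kx <-]]; have [jxmu _ _] := jxP _ (Kl _ Kx).
    exact: lt_le_trans jxmu (le_trans mud dt).
  suff [] : PP kappa lambda (K' j e s) by [].
  apply: (PP_setU kappa_uncountable idN); first by apply: PP_sub (PPK e s) _ => x [].
  split; last exact: card_le_lt_trans (card_image_le _ _) Kk.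
  move=> _ [x Kx <-]; have [jxmu _ _] := jxP _ (Kl _ Kx).
  exact: lt_trans mu_lt_lambda.
pose V j := bdiagU kappa (tau j) eps theta
  (fun e => [set b | PP kappa (tau j) b /\ escapes mu (K' j e) b]).
have Vnull j : (j < mu)%O -> (tau i <= tau j)%O ->
    bNS kappa (tau j) (delta j) theta (V j).
  move=> jmu ij; have [kt _ mud _] := tauP jmu.
  move=> J [bJ _]; have PPK'j e s := PPK' j e s jmu.
  have := bnormal_escapes kappa_uncountable theta_ge2 theta_le_kappa kt mud bJ PPK'j.
  move=> /(ideal_down bJ.1); apply=> b [PPb [e [eeps be Kb]]]; split=> //.
  by exists e; split=> // x /eeps; apply: seg_le; exact: eps_le.
have /choice[c cP] : forall j, exists c, PP kappa lambda c /\
    ((j < mu)%O -> (tau i <= tau j)%O -> forall a, A a -> c `<=` a -> a j ->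
       ~ V j (a `&` seg (tau j))).
  move=> j; have [[jmu ij]|nj] := pselect ((j < mu)%O /\ (tau i <= tau j)%O); last first.
    exists set0; split; last by move=> ? ?; case: nj.
    by split=> //; apply: countable_lt_kappa => //; exact: countable0.
  have [x [xS xk Vx]] := g_cover jmu (Vnull j jmu ij).
  have /choice[cc ccP] : forall e, exists c, S e -> PP kappa lambda c /\
      forall a, PP kappa lambda a -> c `<=` a -> admissible theta a e.
    by move=> e; have [/S_admissible[c cP]|ne] := pselect (S e); [exists c|exists set0].
  exists (\bigcup_(e in x) cc e); split.
    by apply: (PP_bigcup idN xk) => e /xS /ccP[].
  move=> _ _ a Aa ca aj /Vx[e xe ge]; have [PPa aav] := Aav _ Aa.
  apply: (aav j jmu aj e) ge; have [_] := ccP _ (xS _ xe); apply=> // y cy.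
  by apply: ca; exists e.
have PPi : PP kappa lambda [set i].
  split; first by move=> _ ->; exact: lt_trans mu_lt_lambda.
  by apply: countable_lt_kappa => //; exact: countable1.
have /(normalP kappa_uncountable _ idM) nM' := nM.
apply: (ideal_down idM (ideal_setU kappa_uncountable idM (ideal_not_superset idM PPi)
  (nM' (fun j => [set a | PP kappa lambda a /\ ~ c j `<=` a]) _))).
  by move=> j _; apply: ideal_not_superset => //; have [] := cP j.
move=> a [Aa [e [eeps [ea elt] Da]]]; have [PPa _] := Aav _ Aa.
apply: contrapT => nE.
have ai : a i by apply: contrapT => nai; apply: nE; left; split=> // /(_ i erefl).
have ca j : (j < mu)%O -> a j -> c j `<=` a.
  by move=> jmu aj; apply: contrapT => nc; apply: nE; right; split=> //; exists j.
have [s sa] : escapes mu (K e) a by have [_] := KP e; apply.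
apply.
have K'a j : (j < mu)%O -> a j -> (tau i <= tau j)%O -> K' j e s `<=` a.
  move=> jmu aj ij; have [kt _ mud dt] := tauP jmu.
  apply: contrapT => nK'; have [_] := cP j.
  move=> /(_ jmu ij a Aa (ca j jmu aj) aj); apply.
  have PPaj : PP kappa (tau j) (a `&` seg (tau j)).
    split; first by move=> x [].
    by have [_] := PP_sub PPa (@subIsetl _ a (seg (tau j))).
  split=> //; exists e; split=> //.
    split.
      move=> x ex; split; first exact: ea.
      exact: lt_le_trans (eeps _ ex) (le_trans (eps_le j jmu ij) dt).
    apply: (card_lt_le_trans elt); apply: subset_card_le => x [ax xth].
    split=> //; split=> //.
    exact: lt_le_trans xth (le_trans theta_le_kappa kt).
  split=> //; exists s => [x /sa[xmu ax]|sub].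
    split=> //; split=> //; exact: lt_le_trans xmu (le_trans mud dt).
  by apply: nK' => x /sub[].
move=> x Kx; have [Kl _] := PPK e s; have [jmu xj ij] := jxP _ (Kl _ Kx).
have aj : a (jx x) by apply: (K'a i imu ai (lexx _)); right; exists x.
by apply: (K'a _ jmu aj ij); left.
Qed.

(** Properness of the restriction comes from N, which includes M and has A in
its dual. *)
Lemma restr_bnormal A : dual_filter kappa lambda N A ->
  forall chi,
  (forall D, (forall e, e `<=` seg chi -> M (D e `&` A)) ->
     M [set a | A a /\ exists e, [/\ e `<=` seg chi, admissible theta a e & D e a]]) ->
  bnormal_ideal kappa lambda chi theta (ideal_restr kappa lambda M A).
Proof.
move=> [APP NA] chi diag; have [idN _] := bN.
have [idM nM] : ideal kappa lambda M /\ normal kappa lambda mu M.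
  by apply: NS_normal => //; exists N; split=> //; exact: N_normal.
have idMA : ideal kappa lambda (ideal_restr kappa lambda M A).
  apply: restr_ideal => // /(NS_sub idN N_normal) NA'; apply: (ideal_proper idN).
  by rewrite -(setDUK APP); apply: (ideal_setU kappa_uncountable idN).
split=> //; apply/(bnormalP kappa_uncountable _ _ idMA) => D MD.
split; first by move=> a [].
apply: (ideal_down idM (diag D _)) => [e /MD[]//|a [[PPa [e eP]] Aa]].
by split=> //; exists e.
Qed.

End Core.

(** * Cardinals cofinal in lambda *)

Section Cofinality.
Context {d : Order.disp_t} {O : orderType d}.
Hypothesis wfO : wochoice.well_order (<=%O : rel O).
Variables (lambda mu : O).
Hypothesis lambda_singular : singular lambda.
Hypothesis cfE : is_cf lambda mu.

Lemma cf_lt : (mu < lambda)%O.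
Proof.
have [_ [nu [_ [X Xcof /card_eqPle[Xnu _]] _] nul]] := lambda_singular.
have [cmu _ /(_ X Xcof) muX] := cfE.
by apply: le_lt_trans nul; apply: is_card_le => //; exact: card_le_trans Xnu.
Qed.

Lemma cofinal_cards base : (base < lambda)%O -> exists tau : O -> O,
  (forall i, [/\ is_card (tau i), (base <= tau i)%O & (tau i < lambda)%O]) /\
  (forall y, (y < lambda)%O -> exists2 i, (i < mu)%O & (y < tau i)%O).
Proof.
move=> bl; have [_ [X [Xl Xcof] /card_eqPle[/(card_le_surj base)[g Xg] _]] _] := cfE.
have /choice[tau tauP] : forall i, exists c,
    [/\ is_card c, (base <= c)%O, (c < lambda)%O & ((g i < lambda)%O -> (g i <= c)%O)].
  move=> i; have [gl|ngl] := boolP (g i < lambda)%O.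
    have [|c [cc]] := singular_limit wfO (x := Order.max base (g i)) lambda_singular.
      by rewrite gt_max bl.
    by rewrite ge_max => /andP[bc gc] cl; exists c.
  by have [c [cc bc cl]] := singular_limit wfO lambda_singular bl; exists c.
exists tau; split=> [i|y yl]; first by have [] := tauP i.
have [z zl yz] := infinite_card_limit lambda_singular.1 yl.
have [x Xx zx] := Xcof _ zl; have [i imu gx] := Xg _ Xx.
exists i => //; have [_ _ _] := tauP i; rewrite gx => /(_ (Xl _ Xx)).
by apply: lt_le_trans; exact: lt_le_trans zx.
Qed.

End Cofinality.

Lemma bNS_covers (d : Order.disp_t) (O : orderType d) (kappa theta : O) (S : set (set O))
    (tau delta : O -> O) : ~ countable (seg kappa) ->
  (forall i, cof_bar_le kappa (bNS kappa (tau i) (delta i) theta) S) ->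
  exists g : O -> set O -> set (set O),
    (forall i e, bNS kappa (tau i) (delta i) theta (g i e)) /\
    (forall i V, bNS kappa (tau i) (delta i) theta V -> exists x, [/\ x `<=` S,
       card_lt x (seg kappa) & V `<=` \bigcup_(e in x) g i e]).
Proof.
move=> unc cofS; have bNS0 i : bNS kappa (tau i) (delta i) theta set0.
  by move=> J [[idJ _] _]; exact: ideal_set0 idJ.
have /choice[g gP] := fun i => cof_bar_cover (bNS0 i) (cofS i).
by exists g; split=> i; have [] := gP i.
Qed.

(** * Dual filters *)

Section Dual.
Context {d : Order.disp_t} {O : orderType d}.
Variables (kappa sigma : O).
Hypothesis kappa_uncountable : ~ countable (seg kappa).
Implicit Types (A B : set (set O)) (J : set (set (set O))).

Lemma dual_setI J A B : ideal kappa sigma J -> dual_filter kappa sigma J A ->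
  dual_filter kappa sigma J B -> dual_filter kappa sigma J (A `&` B).
Proof.
move=> idJ [APP JA] [_ JB]; split; first by move=> a [/APP].
by rewrite setDIr; apply: (ideal_setU kappa_uncountable idJ).
Qed.

Lemma dual_null J A B : ideal kappa sigma J -> dual_filter kappa sigma J A ->
  B `<=` PP kappa sigma -> J (B `&` A) -> J B.
Proof.
move=> idJ [_ JA] BPP JBA;
apply: (ideal_down idJ (ideal_setU kappa_uncountable idJ JBA JA)).
move=> a Ba; have [Aa|nAa] := pselect (A a); first by left.
by right; split=> //; exact: BPP.
Qed.

Lemma dual_closed mu theta J (S : set (set O)) h :
  bnormal_ideal kappa sigma mu theta J -> (mu <= sigma)%O ->
  (forall a e, PP kappa sigma a -> admissible theta a e -> S e) ->
  (forall e, S e -> (h e < sigma)%O) ->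
  dual_filter kappa sigma J [set a | PP kappa sigma a /\
    forall e, e `<=` seg mu -> admissible theta a e -> a (h e)].
Proof.
move=> [idJ /(bnormalP kappa_uncountable _ _ idJ) nJ] ms aS hS.
split; first by move=> a [].
apply: (ideal_down idJ (nJ (fun e => [set a | S e /\
   (PP kappa sigma a /\ ~ [set h e] `<=` a)]) _)) => [e _|a [PPa na]].
  have [Se|nSe] := pselect (S e); last first.
    by apply: (ideal_down idJ (ideal_set0 _ idJ)) => // a [].
  have PPh : PP kappa sigma [set h e].
    split; first by move=> _ ->; exact: hS.
    by apply: countable_lt_kappa => //; exact: countable1.
  by apply: (ideal_down idJ (ideal_not_superset idJ PPh)) => a [].
split=> //; apply: contrapT => none; apply: na; split=> // e emu ae.
apply: contrapT => nah; apply: none; exists e; split=> //; split; first exact: aS ae.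
by split=> // /(_ _ erefl).
Qed.

End Dual.

(** * The two equalities of ideals *)

Theorem proposition2p1
  (d : Order.disp_t) (O : orderType d)
  (wfO : wochoice.well_order (<=%O : rel O))
  (kappa lambda theta cflambda thetabar : O)
  (kappa_regular : regular kappa)
  (kappa_uncountable : ~ countable (seg kappa))
  (lambda_singular : singular lambda)
  (kappa_lt_lambda : (kappa < lambda)%O)
  (theta_card : is_card theta)
  (theta_ge2 : `I_2 #<= seg theta)
  (theta_le_kappa : (theta <= kappa)%O)
  (cflambdaE : is_cf lambda cflambda)
  (thetabarE : is_bar kappa theta thetabar)
  (ex_lambda : exists J, bnormal_ideal kappa lambda lambda theta J) :
  ((forall tau, is_card tau -> (kappa <= tau)%O -> (tau < lambda)%O ->
      exists J, bnormal_ideal kappa tau tau theta J) ->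
   (thetabar <= cflambda)%O ->
   (forall tau, is_card tau -> (kappa <= tau)%O -> (tau < lambda)%O ->
      cof_bar_le kappa (bNS kappa tau tau theta)
        (Psub (seg thetabar) (seg lambda))) ->
   exists2 A, dual_filter kappa lambda (bNS kappa lambda lambda theta) A &
     bNS kappa lambda lambda theta =
       ideal_restr kappa lambda (NS kappa lambda cflambda) A)
  /\
  (forall chi cfsucc : O,
   is_card chi ->
   is_succ_card cflambda cfsucc ->
   seg kappa `*` seg cfsucc #<= seg chi ->
   (chi < lambda)%O ->
   (forall tau, is_card tau -> (chi <= tau)%O -> (tau <= lambda)%O ->
      exists J, bnormal_ideal kappa tau chi theta J) ->
   (forall tau, is_card tau -> (chi <= tau)%O -> (tau < lambda)%O ->
      cof_bar_le kappa (bNS kappa tau chi theta)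
        (Psub (seg thetabar) (seg lambda))) ->
   exists2 A, dual_filter kappa lambda (bNS kappa lambda lambda theta) A &
     ideal_restr kappa lambda (bNS kappa lambda chi theta) A =
       ideal_restr kappa lambda (NS kappa lambda cflambda) A).
Proof.
have bN := bNS_bnormal kappa_uncountable ex_lambda.
set N := bNS kappa lambda lambda theta in bN *; set M := NS kappa lambda cflambda.
set S := Psub (seg thetabar) (seg lambda).
have kappa_card : is_card kappa by case: kappa_regular => -[].
have mul := cf_lt lambda_singular cflambdaE.
have aS a e := @admissible_bar _ _ wfO kappa lambda theta thetabar thetabarE a e.
have Sa e := bar_admissible wfO kappa_uncountable kappa_card kappa_lt_lambda
  thetabarE bN.1 (e := e).
split=> [_ tm cofN|chi cfsucc cchi [csucc musucc _] kmchi chil _ cofN].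
  have [|tau [tauP tau_cof]] := cofinal_cards wfO lambda_singular cflambdaE
    (base := Order.max kappa cflambda); first by rewrite gt_max kappa_lt_lambda.
  have tauP' i : (i < cflambda)%O -> [/\ (kappa <= tau i)%O, (tau i < lambda)%O,
      (cflambda <= tau i)%O & (tau i <= tau i)%O].
    by have [_ + tl] := tauP i; rewrite ge_max lexx => /andP[].
  have [|g [gnull gcover]] := @bNS_covers _ _ kappa theta S tau tau kappa_uncountable.
    by move=> i; have [ct + tl] := tauP i; rewrite ge_max => /andP[kt _]; exact: cofN.
  have /choice[h hP] : forall e, exists i, S e ->
      (i < cflambda)%O /\ e `<=` seg (tau i).
    move=> e; have [Se|nSe] := pselect (S e); last by exists kappa.
    have [y yl ey] := small_bounded cflambdaE tm Se.
    have [i imu yi] := tau_cof _ yl; exists i => _; split=> // z /ey zy.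
    exact: lt_trans yi.
  set A1 := avoiding kappa lambda cflambda theta tau g.
  have dA1 : dual_filter kappa lambda N A1.
    by apply: (avoiding_dual kappa_uncountable kappa_lt_lambda theta_ge2
      theta_le_kappa mul tauP' bN) => i e _; exact: gnull.
  (* closure under h makes the index h e of a bound of e available to the
     mu-normality of M *)
  have dA2 := @dual_closed _ _ kappa lambda kappa_uncountable lambda theta N S h bN
    (lexx _) aS (fun e Se => lt_trans (hP e Se).1 mul).
  set A2 := (X in dual_filter _ _ _ X) in dA2.
  pose A := A1 `&` A2.
  have dA : dual_filter kappa lambda N A := dual_setI kappa_uncountable bN.1 dA1 dA2.
  exists A => //.
  have nN : normal kappa lambda cflambda N.
    exact: (N_normal kappa_uncountable kappa_lt_lambda theta_ge2 theta_le_kappa mul bN).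
  have [idM nM] : ideal kappa lambda M /\ normal kappa lambda cflambda M.
    by apply: NS_normal => //; exists N; split=> //; exact: bN.1.
  have bMA : bnormal_ideal kappa lambda lambda theta (ideal_restr kappa lambda M A).
    apply: (restr_bnormal kappa_uncountable kappa_lt_lambda theta_ge2
      theta_le_kappa mul bN dA) => D MD.
    have /(normalP kappa_uncountable _ idM) nM' := nM.
    apply: (ideal_down idM (nM' (fun i => [set a | A a /\ exists e,
       [/\ e `<=` seg (tau i), admissible theta a e & D e a]]) _)).
      move=> i imu; apply: (bounded_diagU_null kappa_uncountable kappa_lt_lambda theta_ge2
        theta_le_kappa mul tauP' tau_cof bN Sa (fun i V _ => gcover i V) _ imu) => //.
        by move=> a [].
      move=> e eti; apply: MD => x /eti xt; have [_ til _ _] := tauP' _ imu.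
      exact: lt_trans til.
    move=> a [Aa [e [el ae De]]]; have [[PPa _] [_ A2a]] := Aa.
    have [hmu eh] := hP e (aS _ _ PPa ae).
    by split=> //; exists (h e); split=> //; [exact: A2a|split=> //; exists e].
  apply/seteqP; split; first exact: bNS_sub.
  move=> B [BPP MBA]; apply: (dual_null kappa_uncountable bN.1 dA BPP).
  exact: (NS_sub bN.1 nN).
have [kchi muchi] : (kappa <= chi)%O /\ (cflambda <= chi)%O.
  have [c0 c0P] : exists c0, (c0 < cfsucc)%O by exists cflambda.
  have [k0 k0P] : exists k0, (k0 < kappa)%O.
    apply: contrapT => none; apply: kappa_uncountable.
    suff -> : seg kappa = set0 by exact: countable0.
    by rewrite -subset0 => x xk; apply: none; exists x.
  split.
    apply: is_card_le => //; apply: card_le_trans kmchi.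
    by apply: (card_le_of_inj (f := fun x => (x, c0))) => // x y _ _ [].
  apply: (le_trans (ltW musucc)); apply: is_card_le => //; apply: card_le_trans kmchi.
  by apply: (card_le_of_inj (f := fun x => (k0, x))) => // x y _ _ [].
have [tau [tauP tau_cof]] := cofinal_cards wfO lambda_singular cflambdaE chil.
have tauP' i : (i < cflambda)%O -> [/\ (kappa <= tau i)%O, (tau i < lambda)%O,
    (cflambda <= chi)%O & (chi <= tau i)%O].
  by have [_ ct tl] := tauP i; split=> //; exact: le_trans ct.
have [|g [gnull gcover]] :=
  @bNS_covers _ _ kappa theta S tau (fun=> chi) kappa_uncountable.
  by move=> i; have [ct ? tl] := tauP i; exact: cofN.
set A := avoiding kappa lambda cflambda theta tau g.
have dA : dual_filter kappa lambda N A.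
  by apply: (avoiding_dual kappa_uncountable kappa_lt_lambda theta_ge2
    theta_le_kappa mul tauP' bN) => i e _; exact: gnull.
exists A => //.
have bchi : bnormal_ideal kappa lambda chi theta (bNS kappa lambda chi theta).
  by apply: bNS_bnormal => //; exists N; apply: bnormal_le bN => //; exact: ltW.
have bMA : bnormal_ideal kappa lambda chi theta (ideal_restr kappa lambda M A).
  apply: (restr_bnormal kappa_uncountable kappa_lt_lambda theta_ge2
    theta_le_kappa mul bN dA) => D MD.
  have [i imu _] := tau_cof _ kappa_lt_lambda.
  apply: (bounded_diagU_null kappa_uncountable kappa_lt_lambda theta_ge2
    theta_le_kappa mul tauP' tau_cof bN Sa (fun i V _ => gcover i V) _ imu) => //.
apply/seteqP; split=> B [BPP nB]; split=> //.
  by have [_] := bNS_sub bMA nB; rewrite -setIA setIid.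
apply: NS_sub nB; first exact: bchi.1.
apply: (bnormal_normal kappa_uncountable theta_ge2 theta_le_kappa (ltW kappa_lt_lambda)).
exact: bnormal_le bchi.
Qed.
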